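(* Any deterministic online algorithm for the weighted $k$-server problem on uniform metrics has competitive ratio at least $\Omega(2^{2^{k-4}})$. That is, there is an absolute constant $c>0$ such that for every $k$ and every deterministic online algorithm $\mathrm{ALG}$ for weighted $k$-server on uniform metrics, $\mathrm{ALG}$ is not $\rho$-competitive for any $\rho< c\cdot 2^{2^{k-4}}$ (where the instance, i.e. the number of points of the uniform metric and the server weights, may be chosen adversarially).
   Context: Weighted $k$-server on a uniform metric: there is a finite set $U$ of points with $d(p,q)=1$ for $p\neq q$ and $d(p,p)=0$. There are $k$ servers $s_1,\dots,s_k$ with positive weights $w_1\le \dots\le w_k$, located at points of $U$; moving $s_i$ from $p$ to $q\ne p$ costs $w_i$. A request sequence $\sigma_1,\sigma_2,\dots,\sigma_T\in U$ arrives online; at time $t$, before seeing future requests, the algorithm must have some server at $\sigma_t$. The cost is the total movement cost. A deterministic online algorithm is $\rho$-competitive if there is a constant $\alpha$ (independent of the request sequence) such that for every request sequence its cost is at most $\rho$ times the optimal offline cost plus $\alpha$ (both starting from the same initial configuration); its competitive ratio is the infimum of such $\rho$, taken over all instances (all uniform metrics and all weights). *)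

(* Defs.v *)
From HB Require Import structures.
From mathcomp Require Import all_boot all_order all_algebra.
From mathcomp Require Import all_classical all_reals all_analysis.

Set Implicit Arguments.
Unset Strict Implicit.
Unset Printing Implicit Defensive.

Import Order.TTheory GRing.Theory Num.Theory.
Local Open Scope classical_set_scope.
Local Open Scope ring_scope.

Definition uniform_dist (R : realType) (U : finType) (p q : U) : R :=
  if p == q then 0 else 1.

(* Server [s_(i+1)] is the index [i : 'I_k]; several servers may share a
   point. *)
Definition config (k : nat) (U : finType) : Type := {ffun 'I_k -> U}.

Record instance (R : realType) (k : nat) := Instance {
  points : finType;
  weight : 'I_k -> R;
  weight_gt0 : forall i, 0 < weight i;
  weight_le : forall i j : 'I_k, (i <= j)%N -> weight i <= weight j;
  init : config k points
}.

Section WeightedServer.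
Context (R : realType) (k : nat) (I : instance R k).
Implicit Types (C D : config k (points I)) (r : points I).
Implicit Types (sigma : seq (points I)) (xs : seq (config k (points I))).

Definition move_cost C D : R :=
  \sum_(i < k) weight I i * uniform_dist R (C i) (D i).

Definition covers r C : bool := [exists i, C i == r].

Fixpoint movement_cost C xs : R :=
  if xs is D :: xs' then move_cost C D + movement_cost D xs' else 0.

(* [xs] lists one configuration per request; [all2] forces equal lengths. *)
Definition serves sigma xs : bool := all2 covers sigma xs.

Definition opt_cost sigma : R :=
  inf [set movement_cost (init I) xs | xs in [set xs | serves sigma xs]].

(* [alg_config h] is the configuration reached once the requests of [h] have
   been served; being a function of the requests seen so far makes the
   algorithm deterministic and online. *)
Record online_algorithm := OnlineAlgorithm {
  alg_config : seq (points I) -> config k (points I);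
  alg_config_nil : alg_config [::] = init I;
  alg_config_covers : forall h r, covers r (alg_config (rcons h r))
}.

Definition alg_schedule (A : online_algorithm) sigma :
    seq (config k (points I)) :=
  [seq alg_config A (take t.+1 sigma) | t <- iota 0 (size sigma)].

Definition alg_cost (A : online_algorithm) sigma : R :=
  movement_cost (init I) (alg_schedule A sigma).

End WeightedServer.

(* The algorithm knows the instance (points, weights, initial configuration) in
   advance. *)
Definition server_algorithm (R : realType) (k : nat) : Type :=
  forall I : instance R k, online_algorithm I.

Definition competitive (R : realType) (k : nat) (rho : R)
    (ALG : server_algorithm R k) : Prop :=
  forall I : instance R k, exists alpha : R, forall sigma : seq (points I),
    alg_cost (ALG I) sigma <= rho * opt_cost sigma + alpha.

(* Main.v *)
(** The weights are the powers of a huge number [b]. A play of level [l] is a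
    request sequence on a set [P] of [n_l] points free of the algorithm's
    servers [l], [l+1], ...; it costs the algorithm at least [b ^+ l], but only
    [O(b ^+ l.-1)] offline as soon as one of the servers [l], [l+1], ... stands
    anywhere in [P]. Since [n_(l+1)] points carry a family of sets of size [n_l]
    without common point in which, for every [p], the sets missing [p] do have a
    common point, [n_(l+1)] can be taken about [n_l ^ 2 / 4], whence the doubly
    exponential growth. With [n_(k-1) + 1] points, plays of level [k-1] always
    avoiding the algorithm's heaviest server are expensive for only one of the
    [n_(k-1) + 1] offline schedules that park their heaviest server at a fixed
    point, and averaging over these schedules bounds the optimum. *)

Require Import Defs.
From HB Require Import structures.
From mathcomp Require Import all_boot all_order all_algebra.
From mathcomp Require Import all_classical all_reals all_analysis.
From mathcomp Require Import zify ring lra.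

Set Implicit Arguments.
Unset Strict Implicit.
Unset Printing Implicit Defensive.

Import Order.TTheory GRing.Theory Num.Theory.
Local Open Scope ring_scope.

(** * Set families and sizes of arenas *)

Lemma exists_ord_neq (m : nat) (i : 'I_m.+2) : exists j : 'I_m.+2, j != i.
Proof.
case: (eqVneq i ord0) => [->|i0]; first by exists ord_max.
by exists ord0; rewrite eq_sym.
Qed.

(* The point [(j, None)] lies in every set but the [j]-th one, and the points
   [(j, Some a)] lie in the [j]-th set only. *)
Lemma covering_family (U : finType) (P : {set U}) (m t : nat) :
  #|P| = (m.+2 * t.+1)%N ->
  exists F : 'I_m.+2 -> {set U},
    [/\ forall i, F i \subset P,
        forall i, #|F i| = (m.+1 + t)%N,
        forall x, exists i, x \notin F i &
        forall p, p \in P -> exists q, forall i, p \notin F i -> q \in F i].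
Proof.
move=> cardP; set T := ('I_m.+2 * option 'I_t)%type.
have cardT : #|{: T}| = #|P| by rewrite card_prod card_option !card_ord cardP.
pose g (x : T) := enum_val (cast_ord cardT (enum_rank x)) : U.
have g_inj : injective g.
  by move=> x y /enum_val_inj /cast_ord_inj /enum_rank_inj.
have gP x : g x \in P by exact: enum_valP.
have g_surj p : p \in P -> exists x, p = g x.
  move=> pP; exists (enum_val (cast_ord (esym cardT) (enum_rank_in pP p))).
  by rewrite /g enum_valK cast_ordKV enum_rankK_in.
pose S i : {set T} :=
  finset.setX [set~ i] [set None] :|: finset.setX [set i] [set~ None].
exists (fun i => g @: S i); have gS i x : (g x \in g @: S i) = (x \in S i).
  by rewrite mem_imset.
have SN i j : ((j, None) \in S i) = (j != i) by rewrite !inE /= andbT andbF orbF.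
have SS i j a : ((j, Some a) \in S i) = (j == i).
  by rewrite !inE /= andbF /= andbT.
split.
- by move=> i; apply/fintype.subsetP => _ /imsetP[x _ ->].
- move=> i; rewrite card_imset // cardsU !cardsX !cards1 !cardsC1 card_option.
  rewrite !card_ord mul1n muln1 /= (_ : _ :&: _ = finset.set0) ?cards0 ?subn0 //.
  apply/finset.setP => -[j o]; rewrite !inE /=.
  by case: (j == i); rewrite ?andbF.
- move=> x; case: (boolP (x \in P)) => [/g_surj[[j [a|]] ->]|xP].
  + by have [i ij] := exists_ord_neq j; exists i; rewrite gS SS eq_sym.
  + by exists j; rewrite gS SN eqxx.
  + exists ord0; apply: contra xP => /imsetP[y _ ->]; exact: gP.
- move=> _ /g_surj[[j [a|]] ->].
    by exists (g (j, None)) => i; rewrite !gS SS SN.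
  have [l lj] := exists_ord_neq j; exists (g (l, None)) => i.
  by rewrite !gS !SN negbK => /eqP <-.
Qed.

(** With [n := arena_size l], this is the size [m.+2 * t.+1] in [covering_family] for
    [m.+1 = uphalf n] and [t = n./2]: the members then have exactly [n] points, and the even split
    makes the product largest. *)
Fixpoint arena_size (l : nat) : nat :=
  if l is l'.+1 then
    ((uphalf (arena_size l')).+1 * ((arena_size l')./2).+1)%N
  else 1.

Lemma arena_size_gt0 l : (0 < arena_size l)%N.
Proof. by case: l. Qed.

(** * Composable offline schedules *)

Section OfflineSchedules.
Context (R : realType) (k : nat) (I : instance R k).
Implicit Types (C D E : config k (points I)) (s : seq (points I)).

Lemma uniform_dist_ge0 (U : finType) (p q : U) : 0 <= uniform_dist R p q.
Proof. by rewrite /uniform_dist; case: ifP. Qed.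

Lemma uniform_dist_le1 (U : finType) (p q : U) : uniform_dist R p q <= 1.
Proof. by rewrite /uniform_dist; case: ifP. Qed.

Lemma uniform_dist_triangle (U : finType) (p q r : U) :
  uniform_dist R p r <= uniform_dist R p q + uniform_dist R q r.
Proof.
rewrite /uniform_dist; case: (eqVneq p q) => [->|_]; first by rewrite add0r.
by case: ifP; case: ifP => _ _; rewrite ?addr0 ?ler01 // lerDl ler01.
Qed.

Lemma move_cost_ge0 C D : 0 <= move_cost C D.
Proof.
by apply: sumr_ge0 => i _; rewrite mulr_ge0 ?uniform_dist_ge0 // ltW ?weight_gt0.
Qed.

Lemma move_costxx C : move_cost C C = 0.
Proof.
by rewrite /move_cost big1 // => i _; rewrite /uniform_dist eqxx mulr0.
Qed.

Lemma move_cost_triangle C D E :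
  move_cost C E <= move_cost C D + move_cost D E.
Proof.
rewrite /move_cost -big_split /=; apply: ler_sum => i _.
by rewrite -mulrDr ler_pM2l ?weight_gt0 // uniform_dist_triangle.
Qed.

Lemma move_cost_le_weights C D : move_cost C D <= \sum_i weight I i.
Proof.
apply: ler_sum => i _.
by rewrite ler_piMr ?uniform_dist_le1 // ltW ?weight_gt0.
Qed.

Lemma weight_le_move_cost C D i : C i != D i -> weight I i <= move_cost C D.
Proof.
move=> CD; rewrite /move_cost (bigD1 i) //= /uniform_dist (negbTE CD) mulr1.
rewrite lerDl; apply: sumr_ge0 => j _.
by rewrite mulr_ge0 ?uniform_dist_ge0 // ltW ?weight_gt0.
Qed.

Lemma movement_cost_ge0 C xs : 0 <= movement_cost C xs.
Proof. by elim: xs C => //= D xs IH C; rewrite addr_ge0 ?move_cost_ge0. Qed.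

Lemma movement_cost_cat C xs ys :
  movement_cost C (xs ++ ys) = movement_cost C xs + movement_cost (last C xs) ys.
Proof. by elim: xs C => [|D xs IH] C /=; rewrite ?add0r // IH addrA. Qed.

(* Besides serving [s], [reach C s D c] allows a last move to [D] with no
   request attached, which makes it transitive. *)
Definition reach C s D (c : R) : Prop :=
  exists2 xs, serves s xs & movement_cost C xs + move_cost (last C xs) D <= c.

Lemma reach_nil C D : reach C [::] D (move_cost C D).
Proof. by exists [::] => //=; rewrite add0r. Qed.

Lemma reach_le C s D (c d : R) : c <= d -> reach C s D c -> reach C s D d.
Proof. by move=> cd [xs sxs xsc]; exists xs => //; apply: le_trans cd. Qed.

Lemma reach_cat C D E s1 s2 (c1 c2 : R) :
  reach C s1 D c1 -> reach D s2 E c2 -> reach C (s1 ++ s2) E (c1 + c2).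
Proof.
move=> [xs sxs xsc] [ys sys ysc]; exists (xs ++ ys).
  rewrite /serves; elim: s1 xs sxs {xsc} => [|r s1 IH] [|X xs] //=.
  by case/andP => -> /IH.
rewrite movement_cost_cat last_cat; apply: le_trans (lerD xsc ysc).
case: ys {sys ysc} => [|Y ys] /=.
  by rewrite addr0 add0r -addrA lerD2l move_cost_triangle.
by have := move_cost_triangle (last C xs) D Y; lra.
Qed.

Lemma opt_cost_le_reach s D (c : R) : reach (init I) s D c -> opt_cost s <= c.
Proof.
move=> [xs sxs xsc]; apply: (@le_trans _ _ (movement_cost (init I) xs)).
  apply: ge_inf; last by exists xs.
  by exists 0 => _ [ys _ <-]; exact: movement_cost_ge0.
by apply: le_trans xsc; rewrite lerDl move_cost_ge0.
Qed.

Lemma opt_cost_ge0 s D (c : R) : reach (init I) s D c -> 0 <= opt_cost s.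
Proof.
move=> [xs sxs _]; apply: lb_le_inf.
  by exists (movement_cost (init I) xs), xs.
by move=> _ [ys _ <-]; exact: movement_cost_ge0.
Qed.

End OfflineSchedules.

(** * Cost of the online algorithm after a given history *)

Section OnlineCost.
Context (R : realType) (k : nat) (I : instance R k) (A : online_algorithm I).
Implicit Types (h s : seq (points I)).

Fixpoint cost_from h s : R :=
  if s is r :: s' then
    move_cost (alg_config A h) (alg_config A (rcons h r)) +
    cost_from (rcons h r) s'
  else 0.

Lemma cost_from_cat h s1 s2 :
  cost_from h (s1 ++ s2) = cost_from h s1 + cost_from (h ++ s1) s2.
Proof.
elim: s1 h => [|r s1 IH] h /=; first by rewrite add0r cats0.
by rewrite IH addrA cat_rcons.
Qed.

Lemma alg_cost_from s : alg_cost A s = cost_from [::] s.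
Proof.
have gen h s' : movement_cost (alg_config A h)
    [seq alg_config A (take t.+1 (h ++ s')) | t <- iota (size h) (size s')] =
    cost_from h s'.
  elim: s' h => //= r s' IH h.
  have -> : take (size h).+1 (h ++ r :: s') = rcons h r.
    by rewrite -cat_rcons take_size_cat ?size_rcons.
  by rewrite -IH size_rcons cat_rcons.
by rewrite -gen /alg_cost /alg_schedule alg_config_nil.
Qed.

Lemma move_cost_le_cost_from h s :
  move_cost (alg_config A h) (alg_config A (h ++ s)) <= cost_from h s.
Proof.
elim: s h => [|r s IH] h /=; first by rewrite cats0 move_costxx.
apply: le_trans (move_cost_triangle _ (alg_config A (rcons h r)) _) _.
by rewrite lerD2l -cat_rcons.
Qed.

(** By the triangle inequality, displacing server [i] would already cost its weight. *)
Lemma alg_server_fixed h s (i : 'I_k) : cost_from h s < weight I i ->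
  alg_config A (h ++ s) i = alg_config A h i.
Proof.
move=> cw; apply/eqP; rewrite eq_sym; apply: contraTT cw => /weight_le_move_cost.
by rewrite -leNgt => /le_trans -> //; exact: move_cost_le_cost_from.
Qed.

Lemma reach_mimic h s :
  reach (alg_config A h) s (alg_config A (h ++ s)) (cost_from h s).
Proof.
elim: s h => [|r s IH] h /=.
  by rewrite cats0 -(move_costxx (alg_config A h)); exact: reach_nil.
rewrite -cat_rcons -cat1s; apply: reach_cat (IH _).
exists [:: alg_config A (rcons h r)]; rewrite /serves /= ?alg_config_covers //.
by rewrite move_costxx !addr0.
Qed.

End OnlineCost.

(* Solution of [c 0 = 0], [c l.+1 = b ^+ l + b * c l]. *)
Definition play_cost (R : realType) (b l : nat) : R :=
  l%:R * b%:R ^+ l / b%:R.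

(** * Recursive construction of plays *)

Section Play.
Context (R : realType) (k : nat) (I : instance R k) (A : online_algorithm I).
Context (b : nat) (b_gt0 : (0 < b)%N).
Hypothesis weightE : forall i, weight I i = b%:R ^+ i.
Implicit Types (h s : seq (points I)) (P : {set points I}).

Let cost := cost_from A.

Lemma play_cost_ge0 l : 0 <= play_cost R b l.
Proof. by rewrite /play_cost !mulr_ge0 ?invr_ge0 ?exprn_ge0. Qed.

Lemma play_costS l :
  play_cost R b l.+1 = b%:R ^+ l + b%:R * play_cost R b l.
Proof.
have b0 : b%:R != 0 :> R by rewrite pnatr_eq0 -lt0n.
by rewrite /play_cost exprS -natr1; field.
Qed.

(** Keeping the servers from [l] on in place lets one offline position stay good for a whole chain
    of plays. *)
Definition cheap_play (l : nat) P s : Prop :=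
  forall D : config k (points I),
    (exists2 j : 'I_k, (l <= j)%N & D j \in P) ->
    exists2 D' : config k (points I),
      (forall j : 'I_k, (l <= j)%N -> D' j = D j) &
      reach D s D' (play_cost R b l).

Definition outside (l : nat) h P : Prop :=
  forall j : 'I_k, (l <= j)%N -> alg_config A h j \notin P.

Lemma play0 h P : #|P| = 1%N -> outside 0 h P ->
  exists2 s, 1 <= cost h s & cheap_play 0 P s.
Proof.
move=> /eqP/cards1P[p ->] out; exists [:: p].
  rewrite /cost /= addr0.
  have /existsP[i /eqP ip] := alg_config_covers A h p.
  apply: (@le_trans _ _ (weight I i)).
    by rewrite weightE exprn_ege1 // ler1n.
  apply: weight_le_move_cost; rewrite ip; apply: contraNneq (out i isT) => ->.
  by rewrite inE.
move=> D [j _ /set1P Dj]; exists D => //; exists [:: D].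
  by rewrite /serves /= andbT; apply/existsP; exists j; rewrite Dj.
by rewrite /= !move_costxx !addr0 play_cost_ge0.
Qed.

(* The play of level [l.+1] repeats plays of level [l], each on a member of the
   family that avoids the algorithm's server [l], until its cost reaches
   [b ^+ l.+1]. Offline, a server [j > l] at [p] and server [l] at the partner
   [q] of [p] together meet all members of the family. *)
Lemma play_step l : (l < k)%N ->
  (forall h P, #|P| = arena_size l -> outside l h P ->
     exists2 s, b%:R ^+ l <= cost h s & cheap_play l P s) ->
  forall h P, #|P| = arena_size l.+1 -> outside l.+1 h P ->
    exists2 s, b%:R ^+ l.+1 <= cost h s & cheap_play l.+1 P s.
Proof.
move=> lk IH h P; rewrite [arena_size _]/=.
have := arena_size_gt0 l; case nE: (arena_size l) => [|n] // _.
rewrite /= => /covering_family[F [FP Fcard Favoid Fpair]] out.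
have {}Fcard i : #|F i| = arena_size l by rewrite Fcard nE; lia.
pose sl := Ordinal lk.
(* The minimum records that rounds may stop early; [b] rounds of cost [b ^+ l] always suffice. The
   pair [p], [q] is the same in all rounds. *)
suff rounds m : exists2 s,
    Num.min (b%:R ^+ l.+1) (m%:R * b%:R ^+ l) <= cost h s &
    forall (D : config k (points I)) (j : 'I_k) (p q : points I),
      (l < j)%N -> D j = p -> D sl = q ->
      (forall i, p \notin F i -> q \in F i) ->
      exists2 D' : config k (points I),
        (forall i : 'I_k, (l <= i)%N -> D' i = D i) &
        reach D s D' (m%:R * play_cost R b l).
  have [s cost_s cheap_s] := rounds b; exists s.
    by move: cost_s; rewrite -exprS minxx.
  move=> D [j lj /Fpair[q pq]].
  (* Moving server [l] to [q] once, before the rounds, accounts for the term [b ^+ l] of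
     [play_costS]. *)
  pose E : config k (points I) := [ffun i => if i == sl then q else D i].
  have ED (i : 'I_k) : (l < i)%N -> E i = D i.
    by move=> li; rewrite ffunE -val_eqE /= gtn_eqF.
  have Esl : E sl = q by rewrite ffunE eqxx.
  have [D' D'E sD'] := cheap_s E j _ q lj (ED j lj) Esl pq.
  exists D'; first by move=> i li; rewrite D'E ?ED // ltnW.
  rewrite play_costS -[s]cat0s; apply: reach_cat sD'.
  apply: reach_le (reach_nil _ _); rewrite /move_cost (bigD1 sl) //= big1.
    by rewrite addr0 weightE ler_piMr ?uniform_dist_le1 ?exprn_ge0.
  move=> i /negbTE isl; rewrite ffunE isl /uniform_dist eqxx mulr0 //.
elim: m => [|m [s cost_s cheap_s]].
  exists [::]; first by rewrite mul0r ge_min lexx orbT.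
  move=> D j p q _ _ _ _; exists D => //.
  by rewrite mul0r -(move_costxx D); exact: reach_nil.
(* Below this threshold no server above [l] has left its place, so all of them are still outside [P]
   and another round is possible. *)
have [done|lt_cost] := leP (b%:R ^+ l.+1) (cost h s).
  exists s; first by rewrite ge_min done.
  move=> D j p q lj Dj Dl pq; have [D' D'D sD'] := cheap_s D j p q lj Dj Dl pq.
  exists D' => //; apply: reach_le sD'.
  by rewrite ler_wpM2r ?play_cost_ge0 // ler_nat.
have [i Fi] := Favoid (alg_config A (h ++ s) sl).
have [|s' cost_s' cheap_s'] := IH (h ++ s) (F i) (Fcard i).
  move=> j; rewrite leq_eqVlt => /predU1P[lj|lj].
    by rewrite (_ : j = sl) //; exact: val_inj.
  rewrite alg_server_fixed; last first.
    apply: lt_le_trans lt_cost _; rewrite weightE.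
    by rewrite ler_weXn2l // ler1n.
  by apply: contra (out j lj); apply/fintype.subsetP.
exists (s ++ s').
  rewrite /cost cost_from_cat -/cost -natr1 mulrDl mul1r.
  move: cost_s; rewrite !ge_min => /orP[|le_cost]; first by rewrite leNgt lt_cost.
  by rewrite lerD ?orbT.
move=> D j p q lj Dj Dl pq; have [D' D'D sD'] := cheap_s D j p q lj Dj Dl pq.
have [|D'' D''D' sD''] := cheap_s' D'.
  have [pF|/pq qF] := boolP (p \in F i).
    by exists j; [exact: ltnW|rewrite D'D ?Dj // ltnW].
  by exists sl; rewrite // D'D ?Dl.
exists D''; first by move=> j' lj'; rewrite D''D' ?D'D.
by rewrite -natr1 mulrDl mul1r; exact: reach_cat sD' sD''.
Qed.

Lemma play l : (l <= k)%N -> forall h P, #|P| = arena_size l ->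
  outside l h P -> exists2 s, b%:R ^+ l <= cost h s & cheap_play l P s.
Proof.
elim: l => [_ h P cP out|l IH lk]; first by rewrite expr0; exact: play0.
by apply: play_step => //; apply: IH; exact: ltnW.
Qed.

End Play.

(** * Averaging over the parked schedules *)

Lemma sum_expr_le (R : realType) (b K : nat) : (1 < b)%N ->
  \sum_(i < K.+1) b%:R ^+ i <= 2 * b%:R ^+ K :> R.
Proof.
move=> b1; elim: K => [|K IH].
  by rewrite big_ord_recl big_ord0 addr0 expr0 mulr1 ler1n.
rewrite big_ord_recr /= [2 * _]mulr_natl mulr2n lerD2r; apply: le_trans IH _.
by rewrite exprS ler_wpM2r ?exprn_ge0 // ler_nat.
Qed.

Section Adversary.
Context (R : realType) (K : nat) (I : instance R K.+1) (A : online_algorithm I).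
Context (b : nat).
Hypothesis weightE : forall i, weight I i = b%:R ^+ i.
Hypothesis card_points : #|points I| = (arena_size K).+1.
Hypothesis b_gt1 : (1 < b)%N.

(* While the algorithm keeps its heaviest server at [x], a play of level [K]
   takes place on the complement of [x]: it is cheap for every offline schedule
   parking its heaviest server at [p != x], and the schedule parked at [x]
   imitates the algorithm. *)
Lemma adversary (M : nat) : exists (s : seq (points I)) (f : points I -> R),
  [/\ M%:R * b%:R ^+ K <= cost_from A [::] s,
      forall p, exists2 D : config K.+1 (points I),
        D ord_max = p & reach (init I) s D (f p) &
      \sum_p f p <= #|points I|%:R * (\sum_i weight I i) +
        5 * cost_from A [::] s +
        #|points I|%:R * (M%:R * play_cost R b K)].
Proof.
have b_gt0 := ltnW b_gt1; set W := \sum_i weight I i; set N := #|points I|.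
elim: M => [|M [s [f [cost_s reach_f sum_f]]]].
  exists [::], (fun=> W); split.
  - by rewrite mul0r.
  - move=> p; pose D : config K.+1 (points I) := [ffun=> p].
    exists D; first by rewrite ffunE.
    exact: reach_le (move_cost_le_weights _ _) (reach_nil _ _).
  - by rewrite /= !mul0r !mulr0 !addr0 sumr_const mulr_natl.
set x := alg_config A s ord_max.
have [||s' cost_s' cheap_s'] :=
  @play _ _ _ A _ b_gt0 weightE K (leqnSn K) s [set~ x].
- by rewrite cardsC1 card_points.
- move=> j Kj; rewrite !inE negbK (_ : j = ord_max) //.
  by apply/val_inj/eqP; rewrite eqn_leq -ltnS ltn_ord.
(* The imitating schedule pays at most [W] to join the algorithm, its cost, and [W] to return: at
   most 5 times that cost. *)
have W_le : W <= 2 * cost_from A s s'.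
  apply: le_trans (_ : 2 * b%:R ^+ K <= _); last by rewrite ler_pM2l.
  by rewrite /W (eq_bigr _ (fun i _ => weightE i)) sum_expr_le.
exists (s ++ s'), (fun p => f p + play_cost R b K +
                            if p == x then 5 * cost_from A s s' else 0); split.
- by rewrite cost_from_cat -natr1 mulrDl mul1r lerD.
- move=> p; have [D Dp sD] := reach_f p; have [px|px] := eqVneq p x; last first.
    have [|D' D'D sD'] := cheap_s' D.
      by exists ord_max; rewrite // Dp !inE.
    by exists D'; rewrite ?addr0 ?D'D //; exact: reach_cat sD sD'.
  have -> : s ++ s' = s ++ ([::] ++ (s' ++ [::])) by rewrite cats0.
  exists D => //; apply: reach_le (reach_cat sD (reach_cat (reach_nil D
    (alg_config A s)) (reach_cat (reach_mimic A s s') (reach_nil _ D)))).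
    have := move_cost_le_weights D (alg_config A s).
    have := move_cost_le_weights (alg_config A (s ++ s')) D.
    have := play_cost_ge0 R b K; rewrite -/W; lra.
- rewrite big_split /= -big_mkcond /= big_pred1_eq big_split /= sumr_const -/N.
  rewrite cost_from_cat -[_ *+ _]mulr_natl -natr1.
  by move: sum_f; rewrite -/N; lra.
Qed.

(** The optimum is at most the average of the schedules. For [b] this large all their cheap plays
    together cost at most [M * b ^+ K], hence at most the online cost, which turns the factor 5 into
    6. *)
Lemma opt_cost_le_adversary (M : nat) : (#|points I| * K <= b)%N ->
  exists s : seq (points I),
    [/\ M%:R * b%:R ^+ K <= cost_from A [::] s, 0 <= opt_cost s &
      #|points I|%:R * opt_cost s <=
      #|points I|%:R * (\sum_i weight I i) + 6 * cost_from A [::] s].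
Proof.
move=> NKb; have [s [f [cost_s reach_f sum_f]]] := adversary M.
exists s; split=> //.
  by have [D _ /opt_cost_ge0] := reach_f (init I ord0).
have le_sum : #|points I|%:R * opt_cost s <= \sum_p f p.
  rewrite mulr_natl -sumr_const; apply: ler_sum => p _.
  by have [D _ /opt_cost_le_reach] := reach_f p.
apply: le_trans le_sum (le_trans sum_f _).
suff : #|points I|%:R * (M%:R * play_cost R b K) <= cost_from A [::] s by lra.
apply: le_trans cost_s; rewrite mulrCA ler_wpM2l // /play_cost !mulrA -natrM.
rewrite ler_pdivrMr ?ltr0n ?(ltnW b_gt1) // mulrC ler_wpM2l ?exprn_ge0 //.
by rewrite ler_nat.
Qed.

End Adversary.

(** * The hard instance and the growth of its size *)

Definition geometric_instance (R : realType) (k b N : nat) (b_gt0 : (0 < b)%N) :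
  instance R k.
Proof.
apply: (@Instance R k 'I_N.+1 (fun i => b%:R ^+ i)).
- by move=> i; rewrite exprn_gt0 // ltr0n.
- by move=> i j ij; rewrite ler_weXn2l // ler1n.
- exact: [ffun=> ord0].
Defined.

Lemma not_competitive_arena_size (R : realType) (K : nat)
    (ALG : server_algorithm R K.+1) (rho : R) :
  6 * rho <= (arena_size K)%:R -> ~ competitive rho ALG.
Proof.
move=> rho_le comp; set N := (arena_size K).+1.
pose b := (N * K).+2.
pose I := @geometric_instance R K.+1 b (arena_size K) (ltn0Sn _).
have weightE i : weight I i = b%:R ^+ i by [].
have cardI : #|points I| = N by rewrite card_ord.
have [alpha comp_alpha] := comp I; set A := ALG I in comp_alpha.
set W := \sum_i weight I i.
(* A negative [rho] may be raised to 0 because the optimum is nonnegative. *)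
pose rho' := Num.max rho 0.
have rho'0 : 0 <= rho' by rewrite le_max lexx orbT.
have rho'_le : 6 * rho' <= N%:R - 1.
  have -> : N%:R - 1 = (arena_size K)%:R :> R by rewrite -natr1 addrK.
  by rewrite /rho'; case: (leP rho 0) => _; rewrite ?mulr0.
(* The final inequalities give [c <= N * (rho' * W + alpha)] for the online cost [c], while
   [M <= c]. *)
have [M M_gt] : exists M : nat, N%:R * (rho' * W + alpha) < M%:R.
  exists (Num.bound `|N%:R * (rho' * W + alpha)|).
  exact: le_lt_trans (ler_norm _) (archi_boundP (normr_ge0 _)).
have [|s [cost_s opt0 opt_le]] :=
  @opt_cost_le_adversary R K I A b weightE cardI isT M.
  by rewrite cardI /b; lia.
have := comp_alpha s; rewrite alg_cost_from.
set c := cost_from A [::] s in cost_s opt_le *.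
rewrite cardI -/W in opt_le => comp_s.
have {}comp_s : c <= rho' * opt_cost s + alpha.
  by apply: le_trans comp_s _; rewrite lerD2r ler_wpM2r // le_max lexx.
have c_ge : M%:R <= c.
  by apply: le_trans cost_s; rewrite ler_peMr // exprn_ege1 // ler1n.
have Nc : N%:R * c <= rho' * (N%:R * W + 6 * c) + N%:R * alpha.
  apply: le_trans (_ : N%:R * (rho' * opt_cost s + alpha) <= _).
    by rewrite ler_wpM2l.
  by rewrite mulrDr lerD2r mulrCA ler_wpM2l.
have c0 : 0 <= c by exact: le_trans c_ge.
have := ler_wpM2r c0 rho'_le; nra.
Qed.

Lemma server_algorithm0 (R : realType) : server_algorithm R 0 -> False.
Proof.
move=> ALG; pose I := @geometric_instance R 0 1 0 isT.
by have /existsP[[]] := alg_config_covers (ALG I) [::] (ord0 : points I).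
Qed.

Lemma arena_sizeS_ge l : (arena_size l ^ 2 <= 4 * arena_size l.+1)%N.
Proof.
rewrite /=; set n := arena_size l; have := odd_double_half n.
rewrite uphalf_half; case: (odd n) => /=; nia.
Qed.

Lemma powR2_le_arena_size (R : realType) (l : nat) :
  2 `^ (2 `^ (l%:R - 3)) <= 2 * (arena_size l)%:R :> R.
Proof.
have step (m : nat) :
    (2 `^ (2 `^ (m.+1%:R - 3)) : R) = (2 `^ (2 `^ (m%:R - 3))) ^+ 2.
  rewrite -powR_mulrn ?powR_ge0 // -powRrM; congr (_ `^ _).
  have -> : m.+1%:R - 3 = (m%:R - 3) + 1 :> R by rewrite -natr1; ring.
  by rewrite powRD ?powRr1 // pnatr_eq0 implybT.
have base : 2 `^ (2 `^ (3%:R - 3)) = 2 :> R by rewrite subrr powRr0 powRr1.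
have [l3|l3] := leqP l 3; last first.
  (* The factor 4 survives squaring, since [(4 * a) ^ 2 / 4 = 4 * a ^ 2]; the induction starts at
     [arena_size 3 = 9], which is at least [4 * 2]. *)
  suff H m : 4 * 2 `^ (2 `^ ((m + 3)%:R - 3)) <= (arena_size (m + 3))%:R :> R.
    have := H (l - 3)%N; rewrite subnK 1?ltnW // => H'.
    have := powR_ge0 2 (2 `^ (l%:R - 3) : R); lra.
  elim: m => [|m IH]; first by rewrite add0n base /= -natrM ler_nat.
  rewrite addSn step.
  have := arena_sizeS_ge (m + 3); rewrite -(ler_nat R) natrX natrM => H'.
  have := powR_ge0 2 (2 `^ ((m + 3)%:R - 3) : R).
  nra.
apply: le_trans (_ : 2 <= _); last first.
  by rewrite ler_peMr // ler1n arena_size_gt0.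
rewrite -[leRHS]base; apply: ler_powR; first by rewrite ler1n.
by apply: ler_powR; rewrite ?ler1n // lerD2r ler_nat.
Qed.

Theorem theorem1 (R : realType) :
  exists2 c : R, 0 < c &
    forall (k : nat) (ALG : server_algorithm R k) (rho : R),
      rho < c * 2 `^ (2 `^ (k%:R - 4)) -> ~ competitive rho ALG.
Proof.
(* 12 is the factor 6 of [not_competitive_arena_size] times the factor 2 of
   [powR2_le_arena_size]. *)
exists 12^-1; first by rewrite invr_gt0.
move=> [|K] ALG rho rho_lt; first by case: (server_algorithm0 ALG).
apply: not_competitive_arena_size.
have := powR2_le_arena_size R K.
have <- : K.+1%:R - 4 = K%:R - 3 :> R by rewrite -natr1; ring.
lra.
Qed.
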